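(* Let $K$ be an algebraically closed field and let $n, d \ge 1$ be integers. Let $f = [F] = [F_0 : \ldots : F_n] \in \mathrm{End}_{d/K}^n$ and let $J^*_F \in K[x_0,\ldots,x_n]$ denote its flat Jacobian. Then $V_{\mathbb{P}^n}(J^*_F) = C_f$ as closed subschemes of $\mathbb{P}^n_K$, where $C_f$ is the critical scheme of $f$.
   Context: $\mathrm{End}_{d/K}^n$ is the set of classes $[F]=[F_0:\ldots:F_n]$ (up to simultaneous nonzero scaling) of tuples of homogeneous forms of degree $d$ in $K[x_0,\ldots,x_n]$ with no common zero in $\mathbb{P}^n(K)$, identified with the endomorphism $f: x\mapsto[F_0(x):\ldots:F_n(x)]$ of $\mathbb{P}^n_K$. Flat Jacobian: let $F_i^{\mathrm{univ}} := \sum_{|\alpha|=d} u_{i,\alpha}x^\alpha \in \mathbb{Z}[\mathbf u][\mathbf x]$ ($0\le i\le n$) be the universal tuple, with indeterminates $u_{i,\alpha}$ indexed by $0\le i\le n$ and multi-indices $\alpha\in\mathbb{N}^{n+1}$ with $|\alpha|=d$. Let $J_{n,d} := \det\left(\partial F_i^{\mathrm{univ}}/\partial x_j\right)_{0\le i,j\le n}\in\mathbb{Z}[\mathbf u][\mathbf x]$. It is a fact that $d$ divides $J_{n,d}$ in $\mathbb{Z}[\mathbf u][\mathbf x]$; the generic flat Jacobian is $J^*_{n,d} := \frac1d J_{n,d}\in\mathbb{Z}[\mathbf u][\mathbf x]$. For a tuple $F$ of forms of degree $d$ over $K$, $J^*_F := \theta_F(J^*_{n,d})\in K[\mathbf x]$,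 where $\theta_F:\mathbb{Z}[\mathbf u][\mathbf x]\to K[\mathbf x]$ is the ring homomorphism fixing each $x_j$ and sending $u_{i,\alpha}$ to the coefficient of $x^\alpha$ in $F_i$. It is homogeneous of degree $(n+1)(d-1)$ (possibly zero); $V_{\mathbb{P}^n}$ denotes the closed subscheme it cuts out. Critical scheme: let $f: X \to Y$ be a morphism of nonsingular varieties over $K$ of the same dimension $r$. It induces a homomorphism of vector bundles $f^*(T^*Y)\to T^*X$ and, dually, the differential $f': TX \to f^*(TY)$, a homomorphism of rank-$r$ vector bundles on $X$. The critical scheme $C_f$ is the zero scheme of $\det f'$: the closed subscheme of $X$ which on each open set trivializing both bundles is defined by the determinant of a matrix representing $f'$. *)

(* Defs.v *)
From HB Require Import structures.
From mathcomp Require Import all_boot all_order all_algebra.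
From mathcomp Require Export mpoly.

Set Implicit Arguments.
Unset Strict Implicit.
Unset Printing Implicit Defensive.

Import GRing.Theory.
Local Open Scope ring_scope.

(** * The flat Jacobian *)

Definition expo (n d : nat) : finType :=
  {m : 'X_{1..n.+1 < d.+1} | mdeg m == d}.

(* Labels (i, alpha) of the indeterminates u_(i,alpha).  The library numbers
   the variables of a polynomial ring by an ordinal, hence the use of
   [enum_rank] and [enum_val] below. *)
Definition uidx (n d : nat) : finType := ('I_n.+1 * expo n d)%type.

Definition Zu (n d : nat) := {mpoly int[#|uidx n d|]}.

Definition Funiv (n d : nat) (i : 'I_n.+1) : {mpoly (Zu n d)[n.+1]} :=
  \sum_(m : expo n d)
     ('X_(enum_rank ((i, m) : uidx n d)) : Zu n d) *: 'X_[bmnm (val m)].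

Definition jacobian_mx (n d : nat) : 'M[{mpoly (Zu n d)[n.+1]}]_n.+1 :=
  \matrix_(i, j) mderiv j (Funiv d i).

Definition jacobian (n d : nat) : {mpoly (Zu n d)[n.+1]} :=
  \det (jacobian_mx n d).

(* Integer coefficients are divided one by one; the division is exact by
   [flat_jacobianE]. *)
Definition flat_jacobian (n d : nat) : {mpoly (Zu n d)[n.+1]} :=
  map_mpoly (map_mpoly (fun c : int => (c %/ d%:Z)%Z)) (jacobian n d).

Definition theta (K : fieldType) (n d : nat) (F : 'I_n.+1 -> {mpoly K[n.+1]}) :
    {mpoly (Zu n d)[n.+1]} -> {mpoly K[n.+1]} :=
  map_mpoly (mmap (fun c : int => c%:~R : K)
    (fun k => let: (i, m) := (enum_val k : uidx n d) in
              (F i)@_(bmnm (val m)))).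

Definition flatJ (K : fieldType) (n d : nat) (F : 'I_n.+1 -> {mpoly K[n.+1]}) :
  {mpoly K[n.+1]} := theta F (flat_jacobian n d).

Section Exactness.

Lemma mcoeff_map_mpoly0 (k : nat) (R S : nzRingType) (f : R -> S) m
    (p : {mpoly R[k]}) : f 0 = 0 -> (map_mpoly f p)@_m = f p@_m.
Proof.
move=> f0; rewrite /map_mpoly /mmap raddf_sum /=.
under eq_bigr => i _.
  rewrite mcoeffCM /mmap1 -mpolyXE_id mcoeffX; over.
have [mp|mp] := boolP (m \in msupp p).
  rewrite (bigD1_seq m) ?msupp_uniq //= eqxx mulr1 big1 ?addr0 // => i ne.
  by rewrite (negPf ne) mulr0.
rewrite (memN_msupp_eq0 mp) f0 big_seq big1 // => i ip.
case: eqP => [e|_]; last by rewrite mulr0.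
by move: mp; rewrite -e ip.
Qed.

Lemma euler_mpolyX (R : comNzRingType) (k : nat) (m : 'X_{1..k}) :
  \sum_(j < k) mderiv j 'X_[m] * 'X_j = 'X_[R, m] *+ mdeg m.
Proof.
rewrite mdegE -sumrMnr; apply: eq_bigr => j _.
rewrite mderivX -scalerAl -mpolyXD scaler_nat.
have [->|mj] := eqVneq (m j) 0%N; first by rewrite !mulr0n.
by rewrite submK // lep1mP.
Qed.

Lemma euler_Funiv (n d : nat) (i : 'I_n.+1) :
  \sum_(j < n.+1) mderiv j (Funiv d i) * 'X_j = Funiv d i *+ d.
Proof.
rewrite /Funiv -sumrMnl.
under eq_bigr => j _ do rewrite raddf_sum mulr_suml.
rewrite exchange_big /=; apply: eq_bigr => m _.
under eq_bigr => j _ do rewrite mderivZ -scalerAl.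
by rewrite -scaler_sumr euler_mpolyX (eqP (valP m)) scalerMnr.
Qed.

Lemma jacobianX (n d : nat) :
  exists G, jacobian n d * 'X_ord0 = G *+ d.
Proof.
pose x : 'cV[{mpoly (Zu n d)[n.+1]}]_n.+1 := \col_j 'X_j.
pose F : 'cV[{mpoly (Zu n d)[n.+1]}]_n.+1 := \col_i Funiv d i.
have AF : jacobian_mx n d *m x = F *+ d.
  apply/matrixP => i j; rewrite mulmxnE !mxE -euler_Funiv.
  by apply: eq_bigr => k _; rewrite !mxE.
have := mulmxA (\adj (jacobian_mx n d)) (jacobian_mx n d) x.
rewrite AF mul_adj_mx mul_scalar_mx => /matrixP/(_ ord0 ord0).
rewrite raddfMn mulmxnE [RHS]mxE [x _ _]mxE => <-.
by eexists.
Qed.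

Lemma flat_jacobianE (n d : nat) :
  (0 < d)%N -> flat_jacobian n d *+ d = jacobian n d.
Proof.
move=> d0; have [G JG] := jacobianX n d.
have z0 : (0 %/ d%:Z)%Z = 0 :> int by rewrite div0z.
apply/mpolyP => m; rewrite mcoeffMn.
rewrite mcoeff_map_mpoly0; last first.
  by apply/mpolyP => k; rewrite mcoeff_map_mpoly0 // mcoeff0 z0.
apply/mpolyP => k; rewrite mcoeffMn mcoeff_map_mpoly0 //.
have -> : (jacobian n d)@_m = G@_(U_(ord0) + m) *+ d.
  by rewrite -mcoeffMn -JG mcoeffMX.
rewrite mcoeffMn; set c := _@__.
by rewrite -[in X in (X %/ _)%Z](mulr_natr c) natz mulzK // eqz_nat -lt0n.
Qed.

End Exactness.

(** * Projective space as a classical variety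

   A point of P^n(K) is given by homogeneous coordinates, i.e. by a nonzero
   vector.  Open subsets of P^n are the corresponding cones; a function on an
   open set U is a total function on vectors of which only the values on U
   matter.  As K is algebraically closed and P^n is reduced, sections of the
   structure sheaf are such functions. *)

Section Projective.
Variables (K : closedFieldType) (n : nat).

Definition vec := 'rV[K]_n.+1.
Definition pset := vec -> Prop.
Definition func := vec -> K.

Definition eval (A : {mpoly K[n.+1]}) (p : vec) : K := A.@[p 0].

Definition subcone (V U : pset) : Prop := forall p, V p -> U p.

Definition agree (U : pset) (g h : func) : Prop := forall p, U p -> g p = h p.

Definition zopen (U : pset) : Prop :=
  forall p, U p -> p <> 0 /\
    exists (b : nat) (B : {mpoly K[n.+1]}),
      [/\ B \is b.-homog, eval B p <> 0
        & forall q, q <> 0 -> eval B q <> 0 -> U q].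

(* Near every point of U, g is a quotient of two forms of the same degree,
   the numerator being a multiple of G. *)
Definition locally_fraction (G : {mpoly K[n.+1]}) (U : pset) (g : func) : Prop :=
  forall p, U p ->
    exists (b : nat) (A B : {mpoly K[n.+1]}),
      [/\ G * A \is b.-homog, B \is b.-homog, eval B p <> 0
        & forall q, U q -> eval B q <> 0 -> g q = eval (G * A) q / eval B q].

Definition regular (U : pset) (g : func) : Prop := locally_fraction 1 U g.

(* A closed subscheme is given by its ideal sheaf: [Z U g] says that g is a
   section over U of the ideal sheaf of Z. *)
Definition subscheme := pset -> func -> Prop.

Definition eq_subscheme (Z Z' : subscheme) : Prop :=
  forall U g, zopen U -> (Z U g <-> Z' U g).

(* The ideal sheaf associated with the homogeneous ideal (G), for a form G. *)
Definition V_proj (G : {mpoly K[n.+1]}) : subscheme :=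
  fun U g => regular U g /\ locally_fraction G U g.

(** ** Tangent sheaves

   For a morphism phi to P^n, the sections over U of phi^*(T P^n), the dual of
   phi^*(Omega), are the K-derivations from the structure sheaf of the target
   to the push-forward of the structure sheaf of U.  Such a derivation E maps a
   function h on V to a function [E V h] on the intersection of U and
   phi^-1(V).
   T P^n itself is the case where phi is the identity. *)

Definition vfield := pset -> func -> func.

Definition over_set (U : pset) (phi : vec -> vec) (V : pset) : pset :=
  fun p => U p /\ V (phi p).

Record field_along (phi : vec -> vec) (U : pset) (E : vfield) : Prop := {
  field_regular : forall V h, zopen V -> regular V h ->
    regular (over_set U phi V) (E V h);
  field_restrict : forall V V' h h', zopen V -> zopen V' -> subcone V' V ->
    regular V h -> regular V' h' -> agree V' h h' ->
    agree (over_set U phi V') (E V h) (E V' h');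
  field_const : forall V (c : K), zopen V ->
    agree (over_set U phi V) (E V (fun=> c)) (fun=> 0);
  field_add : forall V h h', zopen V -> regular V h -> regular V h' ->
    agree (over_set U phi V) (E V (fun p => h p + h' p))
      (fun p => E V h p + E V h' p);
  field_leibniz : forall V h h', zopen V -> regular V h -> regular V h' ->
    agree (over_set U phi V) (E V (fun p => h p * h' p))
      (fun p => h (phi p) * E V h' p + h' (phi p) * E V h p)
}.

(* E = \sum_k a_k e_k over U *)
Definition combination (phi : vec -> vec) (U : pset) (E : vfield)
    (a : 'I_n -> func) (e : 'I_n -> vfield) : Prop :=
  forall V h, zopen V -> regular V h ->
    agree (over_set U phi V) (E V h) (fun p => \sum_(k < n) a k p * e k V h p).

(* A trivialization over U of phi^*(T P^n). *)
Definition frame (phi : vec -> vec) (U : pset) (e : 'I_n -> vfield) : Prop :=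
  (forall k, field_along phi U (e k)) /\
  forall W E, zopen W -> subcone W U -> field_along phi W E ->
    (exists a, (forall k, regular W (a k)) /\ combination phi W E a e) /\
    (forall a a', (forall k, regular W (a k)) -> (forall k, regular W (a' k)) ->
      combination phi W E a e -> combination phi W E a' e ->
      forall k, agree W (a k) (a' k)).

(** ** The critical scheme *)

(* f' : T P^n -> phi^*(T P^n), for f = phi. *)
Definition differential (phi : vec -> vec) (D : vfield) : vfield :=
  fun V h => D (fun p => V (phi p)) (fun p => h (phi p)).

(* M represents f' over U in the frames e (source) and e' (target). *)
Definition represents (phi : vec -> vec) (U : pset) (e e' : 'I_n -> vfield)
    (M : vec -> 'M[K]_n) : Prop :=
  (forall k l, regular U (fun p => M p k l)) /\
  forall l, combination phi U (differential phi (e l)) (fun k p => M p k l) e'.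

(* g is a section over U of the ideal sheaf generated by h. *)
Definition ideal_gen (h : func) (U : pset) (g : func) : Prop :=
  forall p, U p -> exists (W : pset) (a : func),
    [/\ zopen W, W p, subcone W U, regular W a
      & agree W g (fun q => a q * h q)].

(* W runs over the open sets trivializing both bundles.  Two frames over W
   differ by an invertible matrix, so the ideal sheaf generated by det M over W
   depends neither on e nor on e'. *)
Definition critical_scheme (phi : vec -> vec) : subscheme :=
  fun U g => regular U g /\
    forall W e e' M, zopen W -> subcone W U ->
      frame id W e -> frame phi W e' -> represents phi W e e' M ->
      ideal_gen (fun p => \det (M p)) W g.

(** ** Endomorphisms *)

Record is_endomorphism (d : nat) (F : 'I_n.+1 -> {mpoly K[n.+1]}) : Prop := {
  endo_homog : forall i, F i \is d.-homog;
  endo_base_free : forall p : vec, p <> 0 -> exists i, eval (F i) p <> 0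
}.

Definition endo (F : 'I_n.+1 -> {mpoly K[n.+1]}) (p : vec) : vec :=
  \row_i eval (F i) p.

End Projective.

(* Main.v *)
Require Import Defs.
From mathcomp Require Import all_boot all_order all_algebra.
From mathcomp Require Import fingroup perm ring.
From Stdlib Require Import ClassicalEpsilon.

(** In homogeneous coordinates choose j with p_j <> 0 and i with F_i(p) <> 0.
    The fields x_j d/dx_l (l <> j) and y_i d/dy_m (m <> i) are frames of T P^n
    near p and of f^*(T P^n), because a derivation is determined by its values
    on the affine coordinates y_m / y_i.  In these frames the differential has
    the entries x_j (F_i d_l F_m - F_m d_l F_i) / F_i^2.  On the other hand
    Euler's identity and Cramer's rule express x_j J^* as the determinant of the
    Jacobian matrix with column j replaced by F; the factor d cancels over Z.
    Clearing that column by row operations gives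
      det = +- (x_j / F_i)^(n+1) J^*,
    so both ideal sheaves are generated near p by the same function up to a unit.
    Any other pair of frames changes the determinant by factors regular near p. *)

Set Implicit Arguments.
Unset Strict Implicit.
Unset Printing Implicit Defensive.

Import GRing.Theory.
Local Open Scope ring_scope.

Section Polynomials.

Lemma muni_eq0 (R : nzRingType) (n : nat) (p : {mpoly R[n.+1]}) :
  muni p = 0 -> p = 0.
Proof.
move=> p0; apply/mpolyP => m; rewrite mcoeff0.
pose res (m : 'X_{1..n.+1}) :=
  [multinom (m (widen_ord (leqnSn n) i)) | i < n].
have res_inj m' : res m' = res m -> m' ord_max = m ord_max -> m' = m.
  move=> er em; apply/mnmP => i.
  have [j ->|->] := unliftP ord_max i; last by [].
  have -> : lift ord_max j = widen_ord (leqnSn n) j.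
    by apply: val_inj; rewrite /= /bump leqNgt ltn_ord.
  by have := congr1 (fun x : 'X_{1..n} => x j) er; rewrite !mnmE.
have := congr1 (fun q : {poly {mpoly R[n]}} => (q`_(m ord_max))@_(res m)) p0.
rewrite muniE coef_sum raddf_sum coef0 mcoeff0 => s0.
have [mp|/memN_msupp_eq0 //] := boolP (m \in msupp p).
move: s0; rewrite (bigD1_seq m) ?msupp_uniq //= big1 => [|m' ne].
  by rewrite addr0 coefZ coefXn eqxx mulr1 mcoeffZ mcoeffX eqxx mulr1.
rewrite coefZ coefXn; have [em|_] := eqVneq (m ord_max) (m' ord_max); last first.
  by rewrite mulr0 mcoeff0.
rewrite mulr1 mcoeffZ mcoeffX; case: eqP => [er|_]; last by rewrite mulr0.
by move: ne; rewrite (res_inj _ er) ?eqxx.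
Qed.

Lemma meval_muni (R : comNzRingType) (n : nat) (p : {mpoly R[n.+1]})
    (v : 'I_n.+1 -> R) :
  p.@[v] = (map_poly (meval (fun i => v (widen_ord (leqnSn n) i))) (muni p)).[v ord_max].
Proof.
rewrite muniE [in LHS](mpolyE p) !raddf_sum /= horner_sum.
apply: eq_bigr => m _; rewrite mevalZ mevalX.
rewrite map_polyZ /= map_polyXn mevalZ mevalX hornerZ hornerXn.
rewrite big_ord_recr /= mulrA; congr (_ * _ * _).
by apply: eq_bigr => i _; rewrite mnmE.
Qed.

Lemma meval_eq0 (K : closedFieldType) (n : nat) (p : {mpoly K[n]}) :
  (forall v, p.@[v] = 0) -> p = 0.
Proof.
elim: n p => [|n IHn] p p0.
  apply/mpolyP => m; rewrite mcoeff0.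
  have [mp|/memN_msupp_eq0 //] := boolP (m \in msupp p).
  have := p0 (fun=> 0); rewrite mevalE (bigD1_seq m) ?msupp_uniq //=.
  rewrite big_ord0 mulr1 big1 ?addr0 // => m' /eqP[].
  by apply/mnmP; case.
apply: muni_eq0; apply/polyP => k; rewrite coef0; apply: IHn => v.
have [q0|/closed_nonrootP[x]] :=
    eqVneq (map_poly (meval v) (muni p)) 0.
  by have := congr1 (fun q : {poly K} => q`_k) q0; rewrite coef_map coef0.
pose w (i : 'I_n.+1) := if unlift ord_max i is Some j then v j else x.
case/negP; rewrite rootE; apply/eqP.
have := p0 w; rewrite meval_muni {2}/w unlift_none => <-; congr (_.[_]).
apply: eq_map_poly => q; apply: meval_eq => i; rewrite /w.
rewrite (_ : widen_ord _ i = lift ord_max i) ?liftK //.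
by apply: val_inj; rewrite /= /bump leqNgt ltn_ord.
Qed.

Lemma meval_dhomog (R : comNzRingType) (n b : nat) (A : {mpoly R[n]})
    (v w : 'I_n -> R) (c : R) :
  A \is b.-homog -> (forall i, w i = c * v i) -> A.@[w] = c ^+ b * A.@[v].
Proof.
move=> /dhomogP hA wv; rewrite !mevalE mulr_sumr [LHS]big_seq [RHS]big_seq.
apply: eq_bigr => m /hA mb; rewrite mulrCA; congr (_ * _).
rewrite -mb /= mdegE -prodrXr -big_split; apply: eq_bigr => i _ /=.
by rewrite wv exprMn.
Qed.

Lemma mulr_mderiv_dhomog (R : comNzRingType) (n b : nat) (A : {mpoly R[n]})
    (i j : 'I_n) : A \is b.-homog -> 'X_i * A^`M(j) \is b.-homog.
Proof.
move=> /dhomogP hA; rewrite /mderiv mulr_sumr big_seq rpred_sum // => m /hA mb.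
have [->|mj] := eqVneq (m j) 0%N; first by rewrite mul0r scale0r mulr0 dhomog0.
rewrite -scalerAr dhomogZ // -mpolyXD dhomogX /= mdegD mdeg1 -mb /=.
have U : (U_(j) <= m)%MM by rewrite lep1mP.
by rewrite -{2}(submK U) mdegD mdeg1 addnC.
Qed.

Lemma mderiv_dhomog (R : nzRingType) (n b : nat) (A : {mpoly R[n]}) (j : 'I_n) :
  A \is b.-homog -> A^`M(j) \is b.-1.-homog.
Proof.
move=> hA; apply/dhomogP => m; rewrite mcoeff_msupp mcoeff_mderiv => nz.
have : (m + U_(j))%MM \in msupp A.
  by rewrite mcoeff_msupp; apply: contraNneq nz => ->; rewrite mul0rn.
by move/(dhomogP _ _ _ hA) => /=; rewrite mdegD mdeg1 addn1 => <-.
Qed.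

Lemma pihomog_dhomogM (R : comNzRingType) (n g b : nat) (G A : {mpoly R[n]}) :
  G \is g.-homog ->
  pihomog mdeg b (G * A) =
    if (g <= b)%N then G * pihomog mdeg (b - g) A else 0.
Proof.
move=> hG; rewrite {1}(pihomog_partitionE (leqnn (mmeasure mdeg A))).
rewrite mulr_sumr raddf_sum /=.
have hterm e : pihomog mdeg b (G * pihomog mdeg e A) =
    if (g + e == b)%N then G * pihomog mdeg e A else 0.
  have hGe := dhomogM hG (pihomogP mdeg e A).
  case: eqP => [<-|/eqP ne]; first by rewrite pihomog_dE.
  exact: pihomog_ne0 ne hGe.
under eq_bigr => e _ do rewrite hterm.
case: leqP => gb; last first.
  by apply: big1 => e _; case: eqP => // e1; move: gb; rewrite -e1 ltnNge leq_addr.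
have [lt|ge] := ltnP (b - g)%N (mmeasure mdeg A).
  rewrite (bigD1 (Ordinal lt)) //= subnKC // eqxx big1 ?addr0 // => e ne.
  case: eqP => // e1; case/eqP: ne; apply: val_inj => /=.
  by rewrite -e1 addKn.
rewrite big1 => [|e _]; last first.
  case: eqP => // e1; move: ge; rewrite -e1 addKn leqNgt.
  by rewrite ltn_ord.
rewrite {1}/pihomog big_seq_cond big_pred0 ?mulr0 // => m; apply: negbTE.
apply/negP => /andP[/mmeasure_mnm_lt mA /eqP mb].
by move: ge; rewrite -mb leqNgt mA.
Qed.

Lemma dhomog_divr (R : idomainType) (n g b : nat) (G A : {mpoly R[n]}) :
  G != 0 -> G \is g.-homog -> G * A \is b.-homog -> A \is (b - g).-homog.
Proof.
move=> G0 hG hGA; have := pihomog_dhomogM b A hG; rewrite pihomog_dE //.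
case: leqP => _ /eqP.
  by rewrite (inj_eq (mulfI G0)) => /eqP ->; apply: pihomogP.
by rewrite mulf_eq0 (negPf G0) /= => /eqP ->; apply: dhomog0.
Qed.

End Polynomials.

Section FlatJacobian.

Definition jac_col (R : comNzRingType) (n : nat) (F : 'I_n.+1 -> {mpoly R[n.+1]})
    (j : 'I_n.+1) : 'M[{mpoly R[n.+1]}]_n.+1 :=
  \matrix_(m, l) if l == j then F m else (F m)^`M(l).

(* Cramer's rule for the system A x = v. *)
Lemma det_replace_col (R : comNzRingType) (n : nat) (A : 'M[R]_n)
    (x : 'I_n -> R) (v : 'I_n -> R) (j : 'I_n) :
  (forall m, \sum_l A m l * x l = v m) ->
  x j * \det A = \det (\matrix_(m, l) if l == j then v m else A m l).
Proof.
move=> Axv; set B := \matrix_(m, l) _.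
pose u : 'cV[R]_n := \col_l x l; pose w : 'cV[R]_n := \col_m v m.
have Au : A *m u = w.
  by apply/matrixP => m k; rewrite !mxE -Axv; apply: eq_bigr => l _; rewrite !mxE.
have := mulmxA (\adj A) A u.
rewrite Au mul_adj_mx mul_scalar_mx => /matrixP/(_ j ord0).
rewrite !mxE mulrC => <-; rewrite (expand_det_col B j).
apply: eq_bigr => m _; rewrite !mxE eqxx mulrC; congr (_ * _).
rewrite /cofactor; congr (_ * \det _); apply/matrixP => a b.
by rewrite !mxE eq_sym (negPf (neq_lift _ _)).
Qed.

Lemma mpoly_int_mulrnI (k l d : nat) (p q : {mpoly {mpoly int[k]}[l]}) :
  (0 < d)%N -> p *+ d = q *+ d -> p = q.
Proof.
move=> d0 e; apply/mpolyP => m; apply/mpolyP => m'.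
have := congr1 (fun r : {mpoly {mpoly int[k]}[l]} => (r@_m)@_m') e.
rewrite /= !mcoeffMn => /eqP.
by rewrite Num.Theory.eqrMn2r eqn0Ngt d0 => /eqP.
Qed.

Lemma det_mulrn_col (R : comNzRingType) (n d : nat) (A B : 'M[R]_n) (j : 'I_n) :
  (forall m, A m j = B m j *+ d) -> col' j A = col' j B ->
  \det A = \det B *+ d.
Proof.
move=> Aj eAB; rewrite (expand_det_col _ j) (expand_det_col B j) -sumrMnl.
apply: eq_bigr => m _; rewrite Aj mulrnAl; congr (_ * _ *+ _).
rewrite /cofactor; congr (_ * \det _); apply/matrixP => a b.
by move/matrixP/(_ (lift m a) b): eAB; rewrite !mxE.
Qed.

Lemma mulX_flat_jacobian (n d : nat) (j : 'I_n.+1) : (0 < d)%N ->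
  'X_j * flat_jacobian n d = \det (jac_col (@Funiv n d) j).
Proof.
move=> d0; apply: (@mpoly_int_mulrnI _ _ d) => //.
rewrite -mulrnAr (flat_jacobianE n d0) /jacobian.
rewrite (@det_replace_col _ _ _ (fun l => 'X_l) (fun m => Funiv d m *+ d)).
  apply: (@det_mulrn_col _ _ _ _ _ j) => [m|]; first by rewrite !mxE eqxx.
  apply/matrixP => a b.
  by rewrite !mxE eq_sym (negPf (neq_lift _ _)).
by move=> m; rewrite -euler_Funiv; apply: eq_bigr => l _; rewrite !mxE.
Qed.

Lemma map_mpoly_mderiv (R S : nzRingType) (n : nat) (f : {additive R -> S})
    (p : {mpoly R[n]}) (i : 'I_n) :
  map_mpoly f p^`M(i) = (map_mpoly f p)^`M(i).
Proof.
apply/mpolyP => m.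
by rewrite mcoeff_map_mpoly !mcoeff_mderiv mcoeff_map_mpoly raddfMn.
Qed.

Variables (K : fieldType) (n d : nat) (F : 'I_n.+1 -> {mpoly K[n.+1]}).

Definition coef_spec : {rmorphism Zu n d -> K} :=
  mmap (intmul (1 : K))
    (fun k => let: (i, m) := (enum_val k : uidx n d) in (F i)@_(bmnm (val m))).

Lemma thetaE : theta (d := d) F = map_mpoly coef_spec.
Proof. by []. Qed.

Hypothesis hF : forall i, F i \is d.-homog.

Lemma theta_Funiv i : theta F (Funiv d i) = F i.
Proof.
rewrite thetaE /Funiv raddf_sum /=.
under eq_bigr => m _.
  rewrite map_mpolyZ map_mpolyX /= mmapX mmap1U enum_rankK; over.
apply/mpolyP => k; rewrite raddf_sum /=.
under eq_bigr => m _ do rewrite mcoeffZ mcoeffX.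
have [kd|kd] := eqVneq (mdeg k) d; last first.
  rewrite (dhomog_nemf_coeff (hF i) kd) big1 // => m _.
  case: eqP => [e|_]; last by rewrite mulr0.
  by move: kd; rewrite -e (eqP (valP m)) eqxx.
have kb : (mdeg k < d.+1)%N by rewrite kd.
have km : mdeg (BMultinom kb) == d by rewrite /= kd.
pose m0 : expo n d := exist _ (BMultinom kb) km.
rewrite (bigD1 m0) //= eqxx mulr1 big1 ?addr0 // => m ne.
case: eqP => [e|_]; last by rewrite mulr0.
by case/eqP: ne; apply: val_inj; apply: val_inj.
Qed.

Lemma mulX_flatJ (j : 'I_n.+1) : (0 < d)%N ->
  'X_j * flatJ d F = \det (jac_col F j).
Proof.
move=> d0; have := congr1 (theta F) (@mulX_flat_jacobian n d j d0).
rewrite thetaE rmorphM /= map_mpolyX -det_map_mx => ->; congr (\det _).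
apply/matrixP => m l; rewrite !mxE; case: eqP => _; first exact: theta_Funiv.
exact: etrans (map_mpoly_mderiv coef_spec (Funiv d m) l)
  (congr1 (mderiv l) (theta_Funiv m)).
Qed.

Lemma flatJ_dhomog : (0 < d)%N -> flatJ d F \is (n.+1 * d.-1).-homog.
Proof.
move=> d0; rewrite -[X in X.-homog](addnK 1).
apply: (@dhomog_divr _ _ _ _ 'X_ord0).
- by rewrite -msupp_eq0 msuppX.
- by rewrite dhomogX /= mdeg1.
rewrite mulX_flatJ // /determinant rpred_sum // => s _.
rewrite mulr_sign; set P := \prod_(m < _) _.
suff hP : P \is (n.+1 * d.-1 + 1).-homog by case: ifP; rewrite ?dhomogN.
rewrite {}/P.
pose r (m : 'I_n.+1) := if s m == ord0 then d else d.-1.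
have -> : (n.+1 * d.-1 + 1 = \sum_m r m)%N.
  rewrite (bigD1 (s^-1 ord0)%g) //= /r permKV eqxx.
  rewrite (eq_bigr (fun=> d.-1)) => [|m].
    by rewrite sum_nat_const cardC1 card_ord mulSn addnAC addn1 prednK.
  by rewrite -(inj_eq (@perm_inj _ s)) permKV => /negPf ->.
elim/big_ind2: _ => [|a p b q ha hb|m _]; first exact: dhomog1.
  exact: dhomogM.
by rewrite mxE /r; case: eqP => // _; apply: mderiv_dhomog.
Qed.

End FlatJacobian.

(** * Regular functions *)

Section RegularFunctions.
Variables (K : closedFieldType) (n : nat).
Implicit Types (U V W : pset K n) (g h : func K n) (p q : vec K n).
Implicit Types (A B C D P Q : {mpoly K[n.+1]}) (b c : nat).

Definition fraction U g p b A B : Prop :=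
  [/\ A \is b.-homog, B \is b.-homog, eval B p <> 0
    & forall q, U q -> eval B q <> 0 -> g q = eval A q / eval B q].

Definition basic U B : pset K n := fun p => U p /\ eval B p <> 0.

Definition chart (i : 'I_n.+1) : pset K n := fun p => p 0 i <> 0.

Definition affine_coord (i l : 'I_n.+1) : func K n := fun p => p 0 l / p 0 i.

Lemma evalD A B p : eval (A + B) p = eval A p + eval B p.
Proof. exact: mevalD. Qed.

Lemma evalM A B p : eval (A * B) p = eval A p * eval B p.
Proof. exact: mevalM. Qed.

Lemma eval1 p : eval 1 p = 1.
Proof. exact: meval1. Qed.

Lemma evalZ x A p : eval (x *: A) p = x * eval A p.
Proof. exact: mevalZ. Qed.

Lemma evalX i p : eval 'X_i p = p 0 i.
Proof. exact: mevalXU. Qed.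

Lemma evalXn A k p : eval (A ^+ k) p = eval A p ^+ k.
Proof. exact: rmorphXn. Qed.

Lemma eval_dhomog0 b A : A \is b.-homog -> (0 < b)%N -> eval A 0 = 0.
Proof.
move=> hA b0; rewrite /eval (@meval_dhomog _ _ b A (fun=> 0) _ 0 hA).
  by rewrite expr0n gtn_eqF ?mul0r.
by move=> i; rewrite mxE mul0r.
Qed.

Lemma mulf_nz (x y : K) : x <> 0 -> y <> 0 -> x * y <> 0.
Proof. by move=> /eqP x0 /eqP y0; apply/eqP; rewrite mulf_neq0. Qed.

Lemma mulf_nzP (x y : K) : x * y <> 0 -> x <> 0 /\ y <> 0.
Proof. by move=> /eqP; rewrite mulf_eq0 negb_or => /andP[/eqP ? /eqP]. Qed.

Lemma evalM_nz A B p : eval A p <> 0 -> eval B p <> 0 -> eval (A * B) p <> 0.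
Proof. by rewrite evalM; apply: mulf_nz. Qed.

Lemma evalM_nzP A B p : eval (A * B) p <> 0 -> eval A p <> 0 /\ eval B p <> 0.
Proof. by rewrite evalM; apply: mulf_nzP. Qed.

Lemma dhomogXU (i : 'I_n.+1) : ('X_i : {mpoly K[n.+1]}) \is 1.-homog.
Proof. by rewrite dhomogX /= mdeg1. Qed.

Lemma zopenI U V : zopen U -> zopen V -> zopen (fun p => U p /\ V p).
Proof.
move=> oU oV p [/oU[p0 [b [B [hB Bp BU]]]] /oV[_ [c [C [hC Cp CV]]]]].
split=> //; exists (b + c)%N, (B * C); split.
- exact: dhomogM.
- exact: evalM_nz.
- by move=> q q0 /evalM_nzP[Bq Cq]; split; [apply: BU|apply: CV].
Qed.

Lemma zopen_nz B b : B \is b.-homog -> zopen (fun p => p <> 0 /\ eval B p <> 0).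
Proof. by move=> hB p [p0 Bp]; split=> //; exists b, B. Qed.

Lemma zopen_basic U B b : B \is b.-homog -> zopen U -> zopen (basic U B).
Proof.
move=> hB oU p [Up Bp]; have [p0 _] := oU _ Up.
have [_ [c [C [hC Cp CU]]]] :=
  zopenI oU (zopen_nz hB) (conj Up (conj p0 Bp)).
split=> //; exists c, C; split=> // q q0 Cq.
by have [? []] := CU _ q0 Cq.
Qed.

Lemma zopen_chart i : zopen (chart i).
Proof.
move=> p pi; split=> [p0|]; first by case: pi; rewrite p0 mxE.
exists 1%N, 'X_i; split; rewrite ?evalX ?dhomogXU // => q _.
by rewrite evalX.
Qed.

Lemma nz_coord p : p <> 0 -> exists i, p 0 i <> 0.
Proof.
move=> /eqP p0; case/rV0Pn: p0 => i /eqP pi; by exists i.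
Qed.

Lemma zopen_vanish V B P q : zopen V -> V q -> eval B q <> 0 ->
  (forall q', V q' -> eval B q' <> 0 -> eval P q' = 0) -> P = 0.
Proof.
move=> oV Vq Bq P0; have [q0 [c [C [hC Cq CV]]]] := oV _ Vq.
have nz R : eval R q <> 0 -> R != 0.
  by move=> Rq; apply/eqP => R0; apply: Rq; rewrite R0 /eval meval0.
have : P * (B * C * 'X_ord0) = 0.
  apply: meval_eq0 => v; pose w : vec K n := \row_i v i.
  have vw R : R.@[v] = eval R w by apply: meval_eq => i; rewrite mxE.
  rewrite vw !evalM evalX.
  have [->|/eqP w0] := eqVneq w 0; first by rewrite mxE !mulr0.
  have [->|/eqP Bw] := eqVneq (eval B w) 0; first by rewrite !mul0r mulr0.
  have [->|/eqP Cw] := eqVneq (eval C w) 0; first by rewrite mulr0 mul0r mulr0.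
  by rewrite P0 ?mul0r //; apply: CV.
have X0 : 'X_ord0 != 0 :> {mpoly K[n.+1]} by rewrite -msupp_eq0 msuppX.
move/eqP; rewrite !mulf_eq0 (negPf (nz _ Bq)) (negPf (nz _ Cq)) (negPf X0).
by rewrite !orbF => /eqP.
Qed.

Lemma regularP U g :
  regular U g <-> forall p, U p -> exists b A B, fraction U g p b A B.
Proof.
split=> H p /H[b [A [B [hA hB Bp gE]]]]; exists b, A, B.
  by split=> //; move: hA gE; rewrite mul1r.
by rewrite mul1r.
Qed.

Lemma fraction_sub U V g p b A B :
  subcone V U -> fraction U g p b A B -> fraction V g p b A B.
Proof. by move=> VU [hA hB Bp gE]; split=> // q /VU; apply: gE. Qed.

Lemma fraction_agree U g h p b A B :
  agree U g h -> fraction U g p b A B -> fraction U h p b A B.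
Proof.
by move=> gh [hA hB Bp gE]; split=> // q Uq Bq; rewrite -gh ?gE.
Qed.

Lemma fraction_move U g p q b A B :
  eval B q <> 0 -> fraction U g p b A B -> fraction U g q b A B.
Proof. by move=> Bq []. Qed.

Lemma fraction_const U x p : fraction U (fun=> x) p 0 x%:MP 1.
Proof.
split; rewrite ?dhomog1 ?eval1 //.
- by rewrite -[x%:MP]mulr1 mul_mpolyC dhomogZ // dhomog1.
- by apply/eqP; rewrite oner_eq0.
- by move=> q _ _; rewrite eval1 divr1 /eval mevalC.
Qed.

Lemma fraction_add U g h p b c A B C D :
  fraction U g p b A B -> fraction U h p c C D ->
  fraction U (fun q => g q + h q) p (b + c) (A * D + C * B) (B * D).
Proof.
move=> [hA hB Bp gE] [hC hD Dp hE]; split.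
- by apply: dhomogD; [|rewrite addnC]; apply: dhomogM.
- exact: dhomogM.
- exact: evalM_nz.
- move=> q Uq /evalM_nzP[Bq Dq]; rewrite gE // hE // evalD !evalM.
  by field; apply/andP; split; apply/eqP.
Qed.

Lemma fraction_mul U g h p b c A B C D :
  fraction U g p b A B -> fraction U h p c C D ->
  fraction U (fun q => g q * h q) p (b + c) (A * C) (B * D).
Proof.
move=> [hA hB Bp gE] [hC hD Dp hE]; split; [exact: dhomogM..|exact: evalM_nz|].
move=> q Uq /evalM_nzP[Bq Dq]; rewrite gE // hE // !evalM.
by field; apply/andP; split; apply/eqP.
Qed.

Lemma regular_fraction U g b A B :
  A \is b.-homog -> B \is b.-homog -> (forall q, U q -> eval B q <> 0) ->
  (forall q, U q -> g q = eval A q / eval B q) -> regular U g.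
Proof.
move=> hA hB B0 gE; apply/regularP => p Up; exists b, A, B; split=> //.
  exact: B0.
by move=> q Uq _; apply: gE.
Qed.

Lemma regular_sub U V g : subcone V U -> regular U g -> regular V g.
Proof.
move=> VU /regularP rg; apply/regularP => p /VU/rg[b [A [B fAB]]].
by exists b, A, B; apply: fraction_sub fAB.
Qed.

Lemma regular_agree U g h : agree U g h -> regular U g -> regular U h.
Proof.
move=> gh /regularP rg; apply/regularP => p /rg[b [A [B fAB]]].
by exists b, A, B; apply: fraction_agree fAB.
Qed.

Lemma regular_const U x : regular U (fun=> x).
Proof. by apply/regularP => p _; do 3 eexists; apply: fraction_const. Qed.

Lemma regular_add U g h :
  regular U g -> regular U h -> regular U (fun p => g p + h p).
Proof.
move=> /regularP rg /regularP rh; apply/regularP => p Up.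
have [b [A [B fAB]]] := rg _ Up; have [c [C [D fCD]]] := rh _ Up.
by do 3 eexists; apply: fraction_add fAB fCD.
Qed.

Lemma regular_mul U g h :
  regular U g -> regular U h -> regular U (fun p => g p * h p).
Proof.
move=> /regularP rg /regularP rh; apply/regularP => p Up.
have [b [A [B fAB]]] := rg _ Up; have [c [C [D fCD]]] := rh _ Up.
by do 3 eexists; apply: fraction_mul fAB fCD.
Qed.

Lemma regular_sum (I : Type) (r : seq I) (a : pred I) U (g : I -> func K n) :
  (forall i, a i -> regular U (g i)) ->
  regular U (fun p => \sum_(i <- r | a i) g i p).
Proof.
move=> rg; elim: r => [|i r IHr].
  by apply: regular_agree (@regular_const U 0) => p _; rewrite big_nil.
have [ai|/negPf ai] := boolP (a i); last first.
  by apply: regular_agree IHr => p _; rewrite big_cons ai.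
apply: regular_agree (regular_add (rg i ai) IHr) => p _.
by rewrite big_cons ai.
Qed.

Lemma regular_prod (I : Type) (r : seq I) U (g : I -> func K n) :
  (forall i, regular U (g i)) -> regular U (fun p => \prod_(i <- r) g i p).
Proof.
move=> rg; elim: r => [|i r IHr].
  by apply: regular_agree (@regular_const U 1) => p _; rewrite big_nil.
apply: regular_agree (regular_mul (rg i) IHr) => p _.
by rewrite big_cons.
Qed.

Lemma regular_det (m : nat) U (M : vec K n -> 'M[K]_m) :
  (forall k l, regular U (fun p => M p k l)) -> regular U (fun p => \det (M p)).
Proof.
move=> rM; apply: regular_sum => s _; apply: regular_mul.
  exact: regular_const.
exact: regular_prod.
Qed.

Lemma regular_affine_coord i l : regular (chart i) (affine_coord i l).
Proof.
apply: (@regular_fraction _ _ 1 'X_l 'X_i); rewrite ?dhomogXU //.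
  by move=> q; rewrite evalX.
by move=> q _; rewrite !evalX.
Qed.

End RegularFunctions.

(** * Derivations and frames *)

Section PartialDerivatives.
Variables (K : closedFieldType) (n : nat).
Implicit Types (U V W : pset K n) (g h : func K n) (p q : vec K n).
Implicit Types (A B C D P Q : {mpoly K[n.+1]}) (b c : nat).
Implicit Types (phi : vec K n -> vec K n) (E : vfield K n).

Definition quotient_rule (j : 'I_n.+1) A B q : K :=
  (eval B q * eval A^`M(j) q - eval A q * eval B^`M(j) q) / eval B q ^+ 2.

(* The value does not depend on the fraction chosen, see [partialE]. *)
Definition partial (j : 'I_n.+1) V h : func K n := fun q =>
  epsilon (inhabits 0) (fun x =>
    exists b A B, fraction V h q b A B /\ x = quotient_rule j A B q).

Lemma quotient_rule_uniq j V h q b c A B C D : zopen V -> V q ->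
  fraction V h q b A B -> fraction V h q c C D ->
  quotient_rule j A B q = quotient_rule j C D q.
Proof.
move=> oV Vq [hA hB /eqP Bq AB] [hC hD /eqP Dq CD].
have BDq : eval (B * D) q <> 0 by apply: evalM_nz; apply/eqP.
have P0 : A * D - C * B = 0.
  apply: (zopen_vanish oV Vq BDq) => q' Vq' /evalM_nzP[Bq' Dq'].
  have := AB _ Vq' Bq'; rewrite CD // {Bq Dq BDq}.
  move/eqP: Bq' => Bq'; move/eqP: Dq' => Dq'.
  rewrite /eval mevalB !mevalM -!/(eval _ _) => e.
  have -> : eval A q' = eval C q' / eval D q' * eval B q' by rewrite e divfK.
  by field.
have E0 : eval A q * eval D q = eval C q * eval B q.
  by apply/eqP; rewrite -subr_eq0 -!evalM /eval -mevalB P0 meval0.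
have E1 : eval A^`M(j) q * eval D q + eval A q * eval D^`M(j) q =
    eval C^`M(j) q * eval B q + eval C q * eval B^`M(j) q.
  apply/eqP; rewrite -subr_eq0 -!evalM -!evalD /eval -mevalB -!mderivM.
  by rewrite -mderivB P0 mderiv0 meval0.
rewrite /quotient_rule.
have -> : eval A q = eval C q * eval B q / eval D q by rewrite -E0 mulfK.
have -> : eval A^`M(j) q = (eval C^`M(j) q * eval B q +
    eval C q * eval B^`M(j) q - eval A q * eval D^`M(j) q) / eval D q.
  by rewrite -E1 addrK mulfK.
have -> : eval A q = eval C q * eval B q / eval D q by rewrite -E0 mulfK.
by field; apply/andP.
Qed.

Lemma partialE j V h q b A B : zopen V -> V q ->
  fraction V h q b A B -> partial j V h q = quotient_rule j A B q.
Proof.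
move=> oV Vq fAB; rewrite /partial.
have ex : exists x, exists b A B,
    fraction V h q b A B /\ x = quotient_rule j A B q.
  by exists (quotient_rule j A B q), b, A, B.
have [c [C [D [fCD ->]]]] := epsilon_spec (inhabits 0) _ ex.
exact: quotient_rule_uniq fCD fAB.
Qed.

Lemma regular_partial i j V h : zopen V -> regular V h ->
  regular V (fun q => q 0 i * partial j V h q).
Proof.
move=> oV /regularP rh; apply/regularP => p Vp.
have [b [A [B fAB]]] := rh _ Vp; have [hA hB Bp hE] := fAB.
exists (b + b)%N, (B * ('X_i * A^`M(j)) - A * ('X_i * B^`M(j))), (B * B).
split; first by rewrite rpredB //; apply: dhomogM => //; apply: mulr_mderiv_dhomog.
- exact: dhomogM.
- exact: evalM_nz.
move=> q Vq /evalM_nzP[Bq _].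
rewrite (partialE _ oV Vq (fraction_move Bq fAB)) /quotient_rule.
rewrite /eval mevalB !mevalM mevalXU -!/(eval _ _).
by field; apply/eqP.
Qed.

Lemma partial_restrict j V V' h h' q : zopen V -> zopen V' -> subcone V' V ->
  regular V h -> agree V' h h' -> V' q -> partial j V h q = partial j V' h' q.
Proof.
move=> oV oV' V'V /regularP rh hh' V'q; have Vq := V'V _ V'q.
have [b [A [B fAB]]] := rh _ Vq; rewrite (partialE _ oV Vq fAB).
by rewrite (partialE _ oV' V'q (fraction_agree hh' (fraction_sub V'V fAB))).
Qed.

Lemma partial_const j V x q : zopen V -> V q -> partial j V (fun=> x) q = 0.
Proof.
move=> oV Vq; rewrite (partialE _ oV Vq (@fraction_const _ _ V x q)).
by rewrite /quotient_rule !mderivC /eval meval0 !mulr0 subrr mul0r.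
Qed.

Lemma partial_add j V g h q : zopen V -> V q -> regular V g -> regular V h ->
  partial j V (fun p => g p + h p) q = partial j V g q + partial j V h q.
Proof.
move=> oV Vq /regularP/(_ _ Vq)[b [A [B fAB]]] /regularP/(_ _ Vq)[c [C [D fCD]]].
rewrite (partialE _ oV Vq fAB) (partialE _ oV Vq fCD).
rewrite (partialE _ oV Vq (fraction_add fAB fCD)) /quotient_rule.
have [_ _ /eqP Bq _] := fAB; have [_ _ /eqP Dq _] := fCD.
rewrite mderivD !mderivM !(evalD, evalM).
by field; apply/andP.
Qed.

Lemma partial_mul j V g h q : zopen V -> V q -> regular V g -> regular V h ->
  partial j V (fun p => g p * h p) q =
    g q * partial j V h q + h q * partial j V g q.
Proof.
move=> oV Vq /regularP/(_ _ Vq)[b [A [B fAB]]] /regularP/(_ _ Vq)[c [C [D fCD]]].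
rewrite (partialE _ oV Vq fAB) (partialE _ oV Vq fCD).
rewrite (partialE _ oV Vq (fraction_mul fAB fCD)) /quotient_rule.
have [_ _ Bq gE] := fAB; have [_ _ Dq hE] := fCD.
rewrite gE // hE //; move/eqP: Bq => Bq; move/eqP: Dq => Dq.
rewrite !mderivM !(evalD, evalM).
by field; apply/andP.
Qed.

Record morphism phi : Prop := {
  morphism_open : forall V, zopen V -> zopen (fun p => V (phi p));
  morphism_regular : forall V h, zopen V -> regular V h ->
    regular (fun p => V (phi p)) (fun p => h (phi p))
}.

Lemma morphism_id : morphism id.
Proof. by []. Qed.

Definition std_field phi (i : 'I_n.+1) (k : 'I_n) : vfield K n :=
  fun V h p => phi p 0 i * partial (lift i k) V h (phi p).

Lemma std_field_along phi U i k :
  morphism phi -> field_along phi U (std_field phi i k).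
Proof.
move=> mphi; split.
- move=> V h oV rh; apply: (@regular_sub _ _ (fun p => V (phi p))); first by move=> p [].
  exact: (morphism_regular mphi oV (regular_partial i (lift i k) oV rh)).
- move=> V V' h h' oV oV' V'V rh _ hh' p [_ V'p].
  by rewrite /std_field (partial_restrict _ oV oV' V'V rh hh').
- by move=> V x oV p [_ Vp]; rewrite /std_field partial_const ?mulr0.
- move=> V h h' oV rh rh' p [_ Vp].
  by rewrite /std_field partial_add // mulrDr.
- move=> V h h' oV rh rh' p [_ Vp].
  by rewrite /std_field partial_mul // mulrDr !(mulrCA (phi p 0 i)).
Qed.

Lemma std_field_coord phi i k l p : chart i (phi p) ->
  std_field phi i k (chart i) (affine_coord i (lift i l)) p = (k == l)%:R.
Proof.
move=> pi; have fX : fraction (chart i) (affine_coord i (lift i l)) (phi p) 1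
    'X_(lift i l) 'X_i.
  split; rewrite ?dhomogXU // ?evalX //.
  by move=> q _ _; rewrite !evalX.
rewrite /std_field (partialE _ (@zopen_chart K n i) pi fX) /quotient_rule.
rewrite !mderivX !mnm1E !evalZ (negPf (neq_lift _ _)) mul0r mulr0 subr0.
rewrite (inj_eq (@lift_inj _ i)) eq_sym !evalX.
have [->|_] := eqVneq k l; last by rewrite mul0r mulr0 mul0r mulr0.
have -> : (U_(lift i l) - U_(lift i l) = 0)%MM.
  by apply/mnmP => a; rewrite mnmBE subnn mnm0E.
by rewrite mpolyX0 eval1; move/eqP: pi => pi; field.
Qed.

End PartialDerivatives.

Section Frames.
Variables (K : closedFieldType) (n : nat).
Implicit Types (U V W : pset K n) (g h : func K n) (p q : vec K n).
Implicit Types (A B C D P Q : {mpoly K[n.+1]}) (b c : nat).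
Implicit Types (phi : vec K n -> vec K n) (E : vfield K n).
Implicit Types (a : 'I_n -> func K n) (e : 'I_n -> vfield K n).

Lemma mpoly_alg_ind (P : {mpoly K[n.+1]} -> Prop) :
  (forall x, P x%:MP) -> (forall i, P 'X_i) ->
  (forall A B, P A -> P B -> P (A + B)) ->
  (forall A B, P A -> P B -> P (A * B)) -> forall A, P A.
Proof.
move=> PC PX PD PM; elim/mpolyind => [|x m A _ _ PA].
  by rewrite -mpolyC0; apply: PC.
apply: (PD) => //; rewrite -mul_mpolyC; apply: (PM); first exact: PC.
rewrite mpolyXE_id; elim/big_ind: _ => [||i _]; first by rewrite -mpolyC1.
  exact: PM.
elim: (m i) => [|k IHk]; first by rewrite expr0 -mpolyC1.
by rewrite exprS; apply: PM.
Qed.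

Definition dehom (i : 'I_n.+1) Q : func K n :=
  fun p => Q.@[fun l => affine_coord i l p].

Lemma dehomE i b A p : A \is b.-homog -> dehom i A p = eval A p / p 0 i ^+ b.
Proof.
move=> hA; rewrite /dehom /eval (@meval_dhomog _ _ b A (p 0) _ (p 0 i)^-1 hA).
  by rewrite exprVn mulrC.
by move=> l; rewrite /affine_coord mulrC.
Qed.

Lemma regular_dehom i Q : regular (chart i) (dehom i Q).
Proof.
elim/mpoly_alg_ind: Q => [x|l|A B rA rB|A B rA rB].
- by apply: regular_agree (@regular_const _ _ _ x) => p _; rewrite /dehom mevalC.
- by apply: regular_agree (@regular_affine_coord _ _ i l) => p _; rewrite /dehom mevalXU.
- by apply: regular_agree (regular_add rA rB) => p _; rewrite /dehom mevalD.
- by apply: regular_agree (regular_mul rA rB) => p _; rewrite /dehom mevalM.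
Qed.

Lemma field_agree phi U E V h h' : field_along phi U E -> zopen V ->
  regular V h -> agree V h h' -> agree (over_set U phi V) (E V h) (E V h').
Proof.
move=> fE oV rh hh'; apply: (field_restrict fE oV oV _ rh _ hh') => //.
exact: regular_agree hh' rh.
Qed.

Lemma field_agree_dehom phi U E E' i Q :
  field_along phi U E -> field_along phi U E' ->
  (forall k, agree (over_set U phi (chart i))
    (E (chart i) (affine_coord i (lift i k)))
    (E' (chart i) (affine_coord i (lift i k)))) ->
  agree (over_set U phi (chart i))
    (E (chart i) (dehom i Q)) (E' (chart i) (dehom i Q)).
Proof.
move=> fE fE' EE'; have oi := @zopen_chart K n i.
have rd := @regular_dehom i.
have const x : agree (chart i) (dehom i x%:MP) (fun=> x).
  by move=> p _; rewrite /dehom mevalC.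
elim/mpoly_alg_ind: Q => [x|l|A B IA IB|A B IA IB] p Up.
- rewrite (field_agree fE oi (rd _) (const x) Up).
  rewrite (field_agree fE' oi (rd _) (const x) Up).
  by rewrite (field_const fE x oi Up) (field_const fE' x oi Up).
- have [k ->|->] := unliftP i l.
    have X : agree (chart i) (dehom i 'X_(lift i k)) (affine_coord i (lift i k)).
      by move=> q _; rewrite /dehom mevalXU.
    rewrite (field_agree fE oi (rd _) X Up) (field_agree fE' oi (rd _) X Up).
    exact: EE'.
  have X : agree (chart i) (dehom i 'X_i) (fun=> 1).
    by move=> q /eqP qi; rewrite /dehom mevalXU /affine_coord divff.
  rewrite (field_agree fE oi (rd _) X Up) (field_agree fE' oi (rd _) X Up).
  by rewrite (field_const fE 1 oi Up) (field_const fE' 1 oi Up).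
- have X : agree (chart i) (dehom i (A + B)) (fun p => dehom i A p + dehom i B p).
    by move=> q _; rewrite /dehom mevalD.
  rewrite (field_agree fE oi (rd _) X Up) (field_agree fE' oi (rd _) X Up).
  rewrite (field_add fE oi (rd A) (rd B) Up) (field_add fE' oi (rd A) (rd B) Up).
  by rewrite IA // IB.
- have X : agree (chart i) (dehom i (A * B)) (fun p => dehom i A p * dehom i B p).
    by move=> q _; rewrite /dehom mevalM.
  rewrite (field_agree fE oi (rd _) X Up) (field_agree fE' oi (rd _) X Up).
  rewrite (field_leibniz fE oi (rd A) (rd B) Up).
  rewrite (field_leibniz fE' oi (rd A) (rd B) Up).
  by rewrite IA // IB.
Qed.

Lemma field_fraction phi U E i V h p b A B : field_along phi U E -> zopen V ->
  regular V h -> U p -> V (phi p) -> chart i (phi p) ->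
  fraction V h (phi p) b A B ->
  E (chart i) (dehom i A) p =
    h (phi p) * E (chart i) (dehom i B) p + dehom i B (phi p) * E V h p.
Proof.
move=> fE oV rh Up Vp ip [hA hB Bp hE]; have oi := @zopen_chart K n i.
pose V' : pset K n := fun q => basic V B q /\ chart i q.
have oV' : zopen V' by apply: zopenI => //; apply: zopen_basic hB oV.
have V'V : subcone V' V by move=> q [[]].
have V'i : subcone V' (chart i) by move=> q [].
have Vp' : over_set U phi V' p by split.
have rd Q : regular V' (dehom i Q) := regular_sub V'i (@regular_dehom i Q).
have rh' : regular V' h := regular_sub V'V rh.
have toV' Q : E (chart i) (dehom i Q) p = E V' (dehom i Q) p.
  exact: (field_restrict fE oi oV' V'i (@regular_dehom i Q) (rd Q) _ Vp').
have hh : agree V' h h by [].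
rewrite !toV' (field_restrict fE oV oV' V'V rh rh' hh Vp').
rewrite -(field_leibniz fE oV' rh' (rd B) Vp').
apply: (field_agree fE oV' (rd A) _ Vp') => q [[Vq Bq] /eqP qi].
rewrite hE // (dehomE _ _ hA) (dehomE _ _ hB).
by move/eqP: Bq => Bq; field; rewrite Bq expf_neq0.
Qed.

Lemma field_uniq phi U E E' i V h :
  field_along phi U E -> field_along phi U E' ->
  (forall p, U p -> chart i (phi p)) ->
  (forall k, agree U
    (E (chart i) (affine_coord i (lift i k)))
    (E' (chart i) (affine_coord i (lift i k)))) ->
  zopen V -> regular V h -> agree (over_set U phi V) (E V h) (E' V h).
Proof.
move=> fE fE' Ui EE' oV rh p [Up Vp].
have [b [A [B fAB]]] := proj1 (regularP _ _) rh _ Vp; have [_ hB Bp _] := fAB.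
have EQ Q : E (chart i) (dehom i Q) p = E' (chart i) (dehom i Q) p.
  apply: (field_agree_dehom Q fE fE') => [k q [Uq _]|]; first exact: EE'.
  by split=> //; apply: Ui.
have := EQ A; rewrite (field_fraction fE oV rh Up Vp (Ui _ Up) fAB).
rewrite (field_fraction fE' oV rh Up Vp (Ui _ Up) fAB) EQ => /addrI.
apply: mulfI; rewrite (dehomE _ _ hB) mulf_neq0 ?invr_eq0 ?expf_neq0 //.
  exact/eqP.
by apply/eqP; apply: Ui.
Qed.

Definition comb a e : vfield K n :=
  fun V h p => \sum_(k < n) a k p * e k V h p.

Lemma comb_field_along phi U a e : (forall k, field_along phi U (e k)) ->
  (forall k, regular U (a k)) -> field_along phi U (comb a e).
Proof.
move=> fe ra; split.
- move=> V h oV rh; apply: regular_sum => k _; apply: regular_mul.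
    by apply: regular_sub (ra k) => p [].
  exact: field_regular.
- move=> V V' h h' oV oV' V'V rh rh' hh' p Up; apply: eq_bigr => k _.
  by rewrite (field_restrict (fe k) oV oV' V'V rh rh' hh' Up).
- move=> V x oV p Up; rewrite /comb big1 // => k _.
  by rewrite (field_const (fe k) x oV Up) mulr0.
- move=> V h h' oV rh rh' p Up; rewrite /comb -big_split; apply: eq_bigr => k _.
  by rewrite (field_add (fe k) oV rh rh' Up) mulrDr.
- move=> V h h' oV rh rh' p Up; rewrite /comb !mulr_sumr -big_split.
  apply: eq_bigr => k _.
  by rewrite (field_leibniz (fe k) oV rh rh' Up) mulrDr !(mulrCA (a k p)).
Qed.

Lemma comb_std_coord phi i a k p : chart i (phi p) ->
  comb a (std_field phi i) (chart i) (affine_coord i (lift i k)) p = a k p.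
Proof.
move=> ip; rewrite /comb (bigD1 k) //= std_field_coord // eqxx mulr1.
rewrite big1 ?addr0 // => l lk.
by rewrite std_field_coord // (negPf lk) mulr0.
Qed.

Lemma std_frame phi U i : morphism phi -> (forall p, U p -> chart i (phi p)) ->
  frame phi U (std_field phi i).
Proof.
move=> mphi Ui; split=> [k|W E oW WU fE]; first exact: std_field_along.
have oi := @zopen_chart K n i; have rc := @regular_affine_coord K n i.
have Wi p : W p -> over_set W phi (chart i) p.
  by move=> Wp; split=> //; apply: Ui; apply: WU.
split.
  pose a k := E (chart i) (affine_coord i (lift i k)).
  have ra k : regular W (a k) by apply: regular_sub Wi (field_regular fE oi (rc _)).
  exists a; split=> // V h oV rh.
  apply: (@field_uniq phi W E (comb a (std_field phi i)) i) => //.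
  - by apply: comb_field_along => // k; exact: std_field_along.
  - by move=> p Wp; have [] := Wi _ Wp.
  - by move=> k p Wp; rewrite comb_std_coord //; have [] := Wi _ Wp.
move=> a a' _ _ ca ca' k p Wp; have [_ ip] := Wi _ Wp.
have := ca _ _ oi (rc (lift i k)) _ (Wi _ Wp).
rewrite (ca' _ _ oi (rc (lift i k)) _ (Wi _ Wp)).
by rewrite -!/(comb _ _ _ _ _) !comb_std_coord.
Qed.

Lemma differential_field_along phi U E : morphism phi ->
  field_along id U E -> field_along phi U (differential phi E).
Proof.
move=> [op rp] [rE sE cE aE lE]; split.
- by move=> V h oV rh; apply: rE; [apply: op|apply: rp].
- move=> V V' h h' oV oV' V'V rh rh' hh'.
  apply: sE; rewrite -?/(subcone _ _); [exact: op|exact: op| |exact: rp|exact: rp|].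
    by move=> p; apply: V'V.
  by move=> p; apply: hh'.
- by move=> V x oV; apply: cE; apply: op.
- by move=> V h h' oV rh rh'; apply: aE; [apply: op|apply: rp|apply: rp].
- by move=> V h h' oV rh rh'; apply: lE; [apply: op|apply: rp|apply: rp].
Qed.

End Frames.

(** * The critical scheme of an endomorphism *)

Section Endomorphisms.

(* Row operations clear column j of N outside row i. *)
Lemma det_clear_col (R : comNzRingType) (n : nat) (N : 'M[R]_n.+1) (i j : 'I_n.+1) :
  \det (\matrix_(r, l) (N i j * N (lift i r) (lift j l)
                          - N (lift i r) j * N i (lift j l))) * N i j =
  (-1) ^+ (i + j) * N i j ^+ n * \det N.
Proof.
set minor := \matrix_(r, l) _; set x := N i j.
pose T : 'M[R]_n.+1 := \matrix_(m, k)
  if m == i then (k == i)%:R else (x * (m == k)%:R - N m j * (k == i)%:R).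
have detT : \det T = x ^+ n.
  rewrite (expand_det_row T i) (bigD1 i) //= big1 => [|k ki]; last first.
    by rewrite mxE eqxx (negPf ki) mul0r.
  rewrite mxE !eqxx mul1r addr0 /cofactor -signr_odd oddD addbb mul1r.
  rewrite -det_scalar; congr (\det _); apply/matrixP => r s; rewrite !mxE.
  rewrite ![lift i _ == i]eq_sym !(negPf (neq_lift _ _)) mulr0 subr0.
  by rewrite (inj_eq (@lift_inj _ i)) mulr_natr.
have TN m l : (T *m N) m l =
    if m == i then N i l else x * N m l - N m j * N i l.
  rewrite mxE; have [->|mi] := eqVneq m i.
    rewrite (bigD1 i) //= big1 => [|k ki]; last first.
      by rewrite mxE eqxx (negPf ki) mul0r.
    by rewrite mxE !eqxx mul1r addr0.
  under eq_bigr => k _ do rewrite mxE (negPf mi) mulrBl.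
  rewrite sumrB; congr (_ - _).
    rewrite (bigD1 m) //= eqxx mulr1 big1 ?addr0 // => k km.
    by rewrite [m == k]eq_sym (negPf km) mulr0 mul0r.
  rewrite (bigD1 i) //= eqxx mulr1 big1 ?addr0 // => k ki.
  by rewrite (negPf ki) mulr0 mul0r.
rewrite -mulrA; have <- : \det (T *m N) = x ^+ n * \det N by rewrite det_mulmx detT.
rewrite (expand_det_col _ j) (bigD1 i) //= big1 => [|m mi]; last first.
  by rewrite TN (negPf mi) [N m j * _]mulrC subrr mul0r.
rewrite addr0 TN eqxx /cofactor -/x.
have -> : row' i (col' j (T *m N)) = minor.
  apply/matrixP => r l; rewrite [in LHS]mxE [in LHS]mxE TN eq_sym.
  by rewrite (negPf (neq_lift _ _)) mxE.
by rewrite [x * _]mulrCA [RHS]mulrA -expr2 sqrr_sign mul1r mulrC.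
Qed.

Variables (K : closedFieldType) (n d : nat) (F : 'I_n.+1 -> {mpoly K[n.+1]}).
Hypotheses (d0 : (0 < d)%N) (hF : is_endomorphism d F).
Implicit Types (p q : vec K n) (A B : {mpoly K[n.+1]}) (i j : 'I_n.+1).

Let hFh := endo_homog hF.

Definition pullback A : {mpoly K[n.+1]} := A \mPo [tuple F i | i < n.+1].

Lemma eval_pullback A p : eval (pullback A) p = eval A (endo F p).
Proof.
rewrite /eval /pullback comp_mpoly_meval; apply: meval_eq => i.
by rewrite tnth_mktuple mxE.
Qed.

Lemma pullback_dhomog b A : A \is b.-homog -> pullback A \is (d * b).-homog.
Proof.
move=> /dhomogP hA; rewrite /pullback comp_mpolyEX big_seq rpred_sum // => m /hA <-.
rewrite dhomogZ // comp_mpolyX /= mdegE big_distrr /=.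
elim/big_ind2: _ => [|a u b' v ha hb|i _]; first exact: dhomog1.
  exact: dhomogM.
by rewrite tnth_mktuple dhomogMn.
Qed.

Lemma endo_nz p : p <> 0 -> endo F p <> 0.
Proof.
move=> /(endo_base_free hF)[i Fi] e; apply: Fi.
by move/matrixP/(_ 0 i): e; rewrite !mxE.
Qed.

Lemma endo0 : endo F 0 = 0.
Proof. by apply/rowP => i; rewrite !mxE (eval_dhomog0 (hFh i)). Qed.

Lemma morphism_endo : morphism (endo F).
Proof.
split=> [V oV p Vp|V h oV /regularP rh].
  have [Fp [b [B [hB Bp BV]]]] := oV _ Vp.
  split; first by move=> p0; apply: Fp; rewrite p0 endo0.
  exists (d * b)%N, (pullback B); split; first exact: pullback_dhomog.
    by rewrite eval_pullback.
  by move=> q q0; rewrite eval_pullback; apply: BV; apply: endo_nz.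
apply/regularP => p /rh[b [A [B [hA hB Bp hE]]]].
exists (d * b)%N, (pullback A), (pullback B).
split; [exact: pullback_dhomog..|by rewrite eval_pullback|].
by move=> q Vq; rewrite !eval_pullback; apply: hE.
Qed.

Definition chart_mx i j p : 'M[K]_n :=
  \matrix_(r, l) (p 0 j * quotient_rule (lift j l) (F (lift i r)) (F i) p).

Lemma differential_std i j r l p : p <> 0 -> eval (F i) p <> 0 ->
  differential (endo F) (std_field id j l) (chart i)
    (affine_coord i (lift i r)) p = chart_mx i j p r l.
Proof.
move=> p0 Fip; rewrite mxE /differential /std_field; congr (_ * _).
apply: (@partialE _ _ _ _ _ _ d).
- exact: morphism_open morphism_endo _ (@zopen_chart K n i).
- by rewrite /chart mxE.
- split; rewrite ?hFh //.
  by move=> q _ _; rewrite /affine_coord !mxE.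
Qed.

Lemma det_chart_mx i j p : eval (F i) p <> 0 ->
  \det (chart_mx i j p) * eval (F i) p ^+ n.+1 =
  (-1) ^+ (i + j) * p 0 j ^+ n.+1 * eval (flatJ d F) p.
Proof.
move=> /eqP f0; set f := eval (F i) p in f0 *.
pose N : 'M[K]_n.+1 := map_mx (fun A => eval A p) (jac_col F j).
have detN : \det N = p 0 j * eval (flatJ d F) p.
  have := congr1 (fun A => eval A p) (mulX_flatJ hFh j d0).
  by rewrite evalM evalX => ->; rewrite /eval -det_map_mx.
have Nj m : N m j = eval (F m) p by rewrite !mxE eqxx.
have Nl m l : N m (lift j l) = eval (F m)^`M(lift j l) p.
  by rewrite !mxE eq_sym (negPf (neq_lift _ _)).
have := det_clear_col N i j; set minor := \matrix_(r, l) _; rewrite detN Nj -/f.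
have -> : chart_mx i j p = (p 0 j / f ^+ 2) *: minor.
  apply/matrixP => r l; rewrite mxE [RHS]mxE [minor r l]mxE !Nj !Nl -/f.
  by rewrite /quotient_rule -/f mulrA mulrAC.
move=> e; rewrite detZ.
have -> : \det minor = (-1) ^+ (i + j) * f ^+ n * (p 0 j * eval (flatJ d F) p) / f.
  by rewrite -e mulfK.
rewrite expr_div_n -exprM mul2n -addnn exprD !exprS; field.
by rewrite f0 expf_neq0.
Qed.

Implicit Types (U V W : pset K n) (g h : func K n).
Implicit Types (e : 'I_n -> vfield K n) (M : vec K n -> 'M[K]_n).

Lemma mul_pred_degree : (n.+1 * d.-1 + n.+1 = d * n.+1)%N.
Proof. by rewrite -mulnSr prednK // mulnC. Qed.

Lemma standard_chart U p : zopen U -> U p -> exists i j,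
  [/\ p 0 j <> 0, eval (F i) p <> 0, zopen (basic U ('X_j * F i))
    & basic U ('X_j * F i) p].
Proof.
move=> oU Up; have [p0 _] := oU _ Up.
have [j pj] := nz_coord p0; have [i Fip] := endo_base_free hF p0.
exists i, j; split=> //; first exact: zopen_basic (dhomogM (dhomogXU K j) (hFh i)) oU.
by split=> //; apply: evalM_nz => //; rewrite evalX.
Qed.

Lemma basic_chart U i j p : zopen U -> basic U ('X_j * F i) p ->
  [/\ U p, p <> 0, chart j p, eval (F i) p <> 0 & chart i (endo F p)].
Proof.
move=> oU [Up /evalM_nzP[]]; rewrite evalX => pj Fip; split=> //.
  by have [] := oU _ Up.
by rewrite /chart mxE.
Qed.

Lemma regular_chart_mx U i j r l : zopen U ->
  regular (basic U ('X_j * F i)) (fun p => chart_mx i j p r l).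
Proof.
move=> oU; set W := basic _ _.
have fd : field_along (endo F) W (differential (endo F) (std_field id j l)).
  apply: differential_field_along; first exact: morphism_endo.
  exact: std_field_along (morphism_id K n).
have oi := @zopen_chart K n i.
have := field_regular fd oi (@regular_affine_coord K n i (lift i r)).
move/(@regular_sub _ _ _ W) => rd.
apply: regular_agree (rd _) => q Wq; have [_ q0 _ Fiq iq] := basic_chart oU Wq.
  exact: differential_std.
by split.
Qed.

Lemma represents_chart_mx U i j : zopen U ->
  represents (endo F) (basic U ('X_j * F i)) (std_field id j)
    (std_field (endo F) i) (chart_mx i j).
Proof.
move=> oU; split=> [r l|l V h oV rh]; first exact: regular_chart_mx.
apply: (@field_uniq _ _ (endo F) _ _
  (comb (fun k p => chart_mx i j p k l) (std_field (endo F) i)) i) => //.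
- apply: differential_field_along; first exact: morphism_endo.
  exact: std_field_along (morphism_id K n).
- apply: comb_field_along => k; last exact: regular_chart_mx.
  exact: std_field_along morphism_endo.
- by move=> p /(basic_chart oU)[].
move=> k p /(basic_chart oU)[_ p0 _ Fip ip].
by rewrite comb_std_coord // differential_std.
Qed.

(* chart_mx = C M B, where B expands the standard frame in e and C consists of
   the affine coordinates of e'. *)
Lemma det_chart_mx_multiple W e e' M i j : zopen W ->
  frame id W e -> frame (endo F) W e' -> represents (endo F) W e e' M ->
  exists u, regular (basic W ('X_j * F i)) u /\
    agree (basic W ('X_j * F i)) (fun q => \det (chart_mx i j q))
      (fun q => u q * \det (M q)).
Proof.
move=> oW [fe He] [fe' _] [rM cM]; set W' := basic _ _.
have oW' : zopen W' by apply: zopen_basic (dhomogM (dhomogXU K j) (hFh i)) oW.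
have W'W : subcone W' W by move=> q [].
have oi := @zopen_chart K n i.
have [b Hb] : exists b : 'I_n -> 'I_n -> func K n, forall l,
    (forall k, regular W' (b l k)) /\
    combination id W' (std_field id j l) (b l) e.
  apply: (@fin_all_exists _ (fun=> 'I_n -> func K n) (fun l b =>
    (forall k, regular W' (b k)) /\ combination id W' (std_field id j l) b e)) => l.
  have fs : field_along id W' (std_field id j l).
    exact: std_field_along (morphism_id K n).
  by have [] := He _ _ oW' W'W fs.
pose B q : 'M[K]_n := \matrix_(k, l) b l k q.
pose C q : 'M[K]_n :=
  \matrix_(r, m) e' m (chart i) (affine_coord i (lift i r)) q.
have CMB q : W' q -> chart_mx i j q = C q *m M q *m B q.
  move=> W'q; have [Wq q0 _ Fiq iq] := basic_chart oW W'q.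
  have rc r := @regular_affine_coord K n i (lift i r).
  apply/matrixP => r l; rewrite -differential_std // /differential.
  have [_ cb] := Hb l.
  rewrite (cb _ _ (morphism_open morphism_endo oi)
              (morphism_regular morphism_endo oi (rc r))) //.
  rewrite [RHS]mxE; apply: eq_bigr => k _; rewrite mulrC [B q k l]mxE.
  congr (_ * _).
  rewrite [LHS](cM k _ _ oi (rc r)) // mxE.
  by apply: eq_bigr => m _; rewrite mulrC [C q r m]mxE.
exists (fun q => \det (C q) * \det (B q)); split; last first.
  by move=> q W'q; rewrite CMB // !det_mulmx mulrAC.
apply: regular_mul; apply: regular_det => k l.
  apply: (@regular_agree _ _ _ (e' l (chart i) (affine_coord i (lift i k)))).
    by move=> q _; rewrite mxE.
  apply: regular_sub (field_regular (fe' l) oi (@regular_affine_coord K n i _)).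
  by move=> q /(basic_chart oW)[].
by apply: regular_agree (proj1 (Hb l) k) => q _; rewrite mxE.
Qed.

Lemma V_proj_sub_critical U g :
  zopen U -> V_proj (flatJ d F) U g -> critical_scheme (endo F) U g.
Proof.
move=> oU [rg fg]; split=> // W e e' M oW WU fe fe' rM p Wp.
have [b [A [B [hJA hB Bp gE]]]] := fg _ (WU _ Wp).
have [i [j [pj Fip oW' W'p]]] := standard_chart oW Wp.
have [u [ru uE]] := det_chart_mx_multiple i j oW fe fe' rM.
set W' := basic W ('X_j * F i) in oW' W'p ru uE.
have oW1 : zopen (basic W' B) by apply: zopen_basic hB oW'.
have [JA0|JA0] := eqVneq (flatJ d F * A) 0.
  exists (basic W' B), (fun=> 0); split=> //; first by move=> q [[]].
    exact: regular_const.
  move=> q [[/WU Uq _] Bq].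
  by rewrite gE // JA0 /eval meval0 !mul0r.
have J0 : flatJ d F != 0 by apply: contraNneq JA0 => ->; rewrite mul0r.
have hJ := flatJ_dhomog hFh d0.
have hA := dhomog_divr J0 hJ hJA.
have bE := dhomog_uniq JA0 hJA (dhomogM hJ hA).
pose w q := eval (A * F i ^+ n.+1) q / eval (B * 'X_j ^+ n.+1) q.
have rw : regular (basic W' B) w.
  apply: (@regular_fraction _ _ _ _ (b + n.+1)
    (A * F i ^+ n.+1) (B * 'X_j ^+ n.+1)) => //.
  - have -> : (b + n.+1 = (b - n.+1 * d.-1) + d * n.+1)%N.
      by rewrite {1}bE -mul_pred_degree addnCA addnA.
    by apply: dhomogM => //; apply: dhomogMn.
  - by apply: dhomogM => //; rewrite -[X in X.-homog]mul1n; apply/dhomogMn/dhomogXU.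
  - move=> q [/(basic_chart oW)[_ _ /eqP qj _ _] Bq]; apply: evalM_nz => //.
    by rewrite evalXn evalX; apply/eqP; rewrite expf_neq0.
exists (basic W' B), (fun q => w q * ((-1) ^+ (i + j) * u q)).
split=> //; first by move=> q [[]].
  apply: regular_mul rw (regular_mul (@regular_const _ _ _ _) _).
  by apply: regular_sub ru => q [].
move=> q [W'q Bq]; have [Wq _ /eqP qj Fiq _] := basic_chart oW W'q.
rewrite -!mulrA -uE // gE //; last exact: WU.
have := det_chart_mx j Fiq; rewrite /w !evalM !evalXn evalX.
move/eqP: Fiq => Fiq; move/eqP: Bq => Bq.
move/(canRL (mulfK (expf_neq0 _ Fiq))) => ->.
rewrite !mulrA -[_ / _ * _ * _]mulrA -expr2 sqrr_sign mulr1.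
by field; rewrite Bq !expf_neq0.
Qed.

Lemma critical_sub_V_proj U g :
  zopen U -> critical_scheme (endo F) U g -> V_proj (flatJ d F) U g.
Proof.
move=> oU [rg cg]; split=> // p Up.
have [i [j [pj Fip oW Wp]]] := standard_chart oU Up.
set W := basic U _ in oW Wp.
have WU : subcone W U by move=> q [].
have fs : frame id W (std_field id j).
  apply: std_frame; first exact: morphism_id.
  by move=> q /(basic_chart oU)[].
have ft : frame (endo F) W (std_field (endo F) i).
  apply: std_frame; first exact: morphism_endo.
  by move=> q /(basic_chart oU)[].
have [W2 [a [oW2 W2p W2W ra gE]]] :=
  cg _ _ _ _ oW WU fs ft (represents_chart_mx i j oU) p Wp.
have [b [A [B [hA hB Bp aE]]]] := proj1 (regularP _ _) ra _ W2p.
have [_ [c [C [hC Cp CW2]]]] := oW2 _ W2p.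
have hJ := flatJ_dhomog hFh d0.
have hX k : ('X_j : {mpoly K[n.+1]}) ^+ k \is k.-homog.
  by rewrite -[X in X.-homog]mul1n; apply/dhomogMn/dhomogXU.
exists (b + c + n.+2 + n.+1 * d.-1)%N,
  ((-1) ^+ (i + j) *: (A * C * 'X_j ^+ n.+2)), (B * C * ('X_j * F i ^+ n.+1)).
split.
- rewrite [X in X.-homog]addnC; apply: dhomogM => //.
  by rewrite dhomogZ // !dhomogM.
- have -> : (b + c + n.+2 + n.+1 * d.-1 = b + c + (1 + d * n.+1))%N.
    by rewrite -mul_pred_degree -addnA [(_ * _ + n.+1)%N]addnC.
  apply: dhomogM; first exact: dhomogM.
  by apply: dhomogM; [exact: dhomogXU|exact: dhomogMn].
- have Xp : eval 'X_j p <> 0 by rewrite evalX.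
  apply: evalM_nz; apply: evalM_nz => //.
  by rewrite evalXn; apply/eqP; rewrite expf_neq0 //; apply/eqP.
move=> q Uq /evalM_nzP[/evalM_nzP[Bq Cq] _].
have [q0 _] := oU _ Uq; have W2q := CW2 _ q0 Cq.
have [_ _ /eqP qj Fiq _] := basic_chart oU (W2W _ W2q).
have dE := det_chart_mx j Fiq.
rewrite gE // aE // !(evalM, evalZ, evalXn, evalX).
move/eqP: Fiq => Fiq; move/eqP: Bq => Bq; move/eqP: Cq => Cq.
rewrite (canRL (mulfK (expf_neq0 _ Fiq)) dE) !exprS.
by field; rewrite Cq Bq qj Fiq !expf_neq0.
Qed.

End Endomorphisms.

Theorem theorem1p3 (K : closedFieldType) (n d : nat) (hn : (0 < n)%N)
    (hd : (0 < d)%N) (F : 'I_n.+1 -> {mpoly K[n.+1]})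
    (hF : is_endomorphism d F) :
  eq_subscheme (V_proj (flatJ d F)) (critical_scheme (endo F)).
Proof.
move=> U g oU; split; first exact: V_proj_sub_critical.
exact: critical_sub_V_proj.
Qed.
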